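(* Let $A$ be a $4$-dimensional non-split non-Lie nilpotent Leibniz algebra over $\mathbb{C}$ with $\dim(A^2)=2$, $\dim(A^3)=0$ and $\dim(\mathrm{Leib}(A))=1$. Then $A$ is isomorphic to a Leibniz algebra spanned by $\{x_1,x_2,x_3,x_4\}$ (a basis) with the nonzero products given by one of the following: $\mathcal{A}_8$: $[x_1,x_1]=x_4,\ [x_1,x_2]=x_3=-[x_2,x_1]$. $\mathcal{A}_9$: $[x_1,x_1]=x_4,\ [x_1,x_2]=x_3=-[x_2,x_1],\ [x_2,x_2]=x_4$.
   Context: All algebras are over $\mathbb{C}$. A (left) Leibniz algebra is a $\mathbb{C}$-vector space $A$ with a bilinear product $[\,,\,]:A\times A\to A$ such that every left multiplication operator is a derivation, i.e. $[a,[b,c]]=[[a,b],c]+[b,[a,c]]$ for all $a,b,c\in A$. Put $A^1=A$ and $A^i=[A,A^{i-1}]$ (the span of the products) for $i\ge 2$; $A$ is nilpotent if $A^{c+1}=0$ for some positive integer $c$. $\mathrm{Leib}(A)=\mathrm{span}\{[a,a]\mid a\in A\}$; $A$ is a Lie algebra if and only if $\mathrm{Leib}(A)=0$, and ''non-Lie'' means $\mathrm{Leib}(A)\ne 0$. $A$ is split if it is a direct sum of two nontrivial ideals, and non-split otherwise. Products of basis elements not listed are zero. *)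

(* Defs.v *)
From HB Require Import structures.
From mathcomp Require Import all_boot all_order all_algebra.
From mathcomp Require Import all_classical all_reals.
From mathcomp Require Import complex.

Set Implicit Arguments.
Unset Strict Implicit.
Unset Printing Implicit Defensive.

Import GRing.Theory.
Local Open Scope classical_set_scope.
Local Open Scope ring_scope.

HB.mixin Record hasLeibnizBracket (K : fieldType) A of Vector K A := {
  brk : A -> A -> A;
  brk_is_bilinear : bilinear_for *:%R *:%R brk;
  brk_leibniz : forall a b c : A,
    brk a (brk b c) = brk (brk a b) c + brk b (brk a c)
}.

#[short(type="leibnizAlgType")]
HB.structure Definition LeibnizAlgebra (K : fieldType) :=
  {A of hasLeibnizBracket K A & Vector K A}.

HB.instance Definition _ (K : fieldType) (A : leibnizAlgType K) :=
  bilinear_isBilinear.Build K A A A *:%R *:%R (@brk K A) (@brk_is_bilinear K A).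

Section Span.
Variables (K : fieldType) (V : vectType K).
Implicit Types (S : set V) (U : {vspace V}).

Lemma vspan_exists S : exists s : seq V,
  (forall x, x \in s -> S x) /\ (forall x, S x -> x \in <<s>>%VS).
Proof.
suff H n : exists s : seq V, (forall x, x \in s -> S x) /\
    ((forall x, S x -> x \in <<s>>%VS) \/ (n <= \dim <<s>>)%N).
  have [s [sS [//|]]] := H (\dim {:V}).+1; first by exists s.
  by rewrite ltnNge dimvS ?subvf.
elim: n => [|n [s [sS [Ss|ns]]]]; first by exists [::]; split=> //; right.
  by exists s; split=> //; left.
have [Ss|] := pselect (forall x, S x -> x \in <<s>>%VS).
  by exists s; split=> //; left.
move=> /existsNP[x /not_implyP[Sx /negP xs]].
exists (x :: s); split.
  by move=> y; rewrite inE => /predU1P[->//|/sS].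
right; rewrite (leq_ltn_trans ns)// ltnNge; apply/negP => le_dim.
have sub : (<<s>> <= <<x :: s>>)%VS by rewrite span_cons addvSr.
have /eqP E : (<<s>> == <<x :: s>>)%VS by rewrite eqEdim sub.
by move/negP: xs; apply; rewrite E memv_span ?mem_head.
Qed.

(* Since V is finite-dimensional, some finite sequence of elements of S spans
   everything in S; vspanP and mem_vspan show that the choice is irrelevant. *)
Definition vspan S : {vspace V} := <<sval (cid (vspan_exists S))>>%VS.

Lemma vspanP S U : (vspan S <= U)%VS <-> (forall x, S x -> x \in U).
Proof.
rewrite /vspan; case: cid => s /= [sS Ss]; split=> [sU x /Ss|SU].
  exact: (subvP sU).
by apply/span_subvP => x /sS /SU.
Qed.

Lemma mem_vspan S v : v \in vspan S <->
  exists2 s : seq V, (forall x, x \in s -> S x) & v \in <<s>>%VS.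
Proof.
split=> [|[s sS]].
  by rewrite /vspan; case: cid => s /= [sS _] vs; exists s.
apply: subvP; apply/span_subvP => x /sS Sx.
by have /vspanP := subvv (vspan S); apply.
Qed.

End Span.

Section LeibnizTheory.
Variables (K : fieldType) (A : leibnizAlgType K).

(* lcs i is A^i for i >= 1; lcs 0 is a junk value. *)
Fixpoint lcs (i : nat) : {vspace A} :=
  match i with
  | j.+1 => if j is 0%N then fullv
            else vspan [set brk a b | a in setT & b in [set` lcs j]]
  | 0%N => fullv
  end.

Definition nilpotent_leibniz := exists2 c : nat, (0 < c)%N & lcs c.+1 = 0%VS.

Definition Leib : {vspace A} := vspan [set brk a a | a in setT].

Definition is_ideal (I : {vspace A}) :=
  forall a x : A, x \in I -> brk a x \in I /\ brk x a \in I.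

Definition split_leibniz := exists I J : {vspace A},
  [/\ is_ideal I /\ is_ideal J, I != 0%VS /\ J != 0%VS,
      (I + J)%VS = fullv & (I :&: J)%VS = 0%VS].

End LeibnizTheory.

Arguments lcs {K} A i.
Arguments nilpotent_leibniz {K} A.
Arguments Leib {K} A.
Arguments split_leibniz {K} A.

Definition leibniz_isomorphic (K : fieldType) (A B : leibnizAlgType K) :=
  exists2 f : {linear A -> B}, bijective f & {morph f : a b / brk a b}.

Section Table.
Variables (K : fieldType) (n : nat).
Implicit Types T : 'I_n -> 'I_n -> 'rV[K]_n.

(* The bilinear product on K^n with [e_i, e_j] = T i j. *)
Definition table_brk T (u v : 'rV[K]_n) : 'rV[K]_n :=
  \sum_i \sum_j (u 0 i * v 0 j) *: T i j.

Lemma table_brk_bilinear T : bilinear_for *:%R *:%R (table_brk T).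
Proof.
split=> w a u v /=; rewrite /table_brk scaler_sumr -big_split; apply: eq_bigr => i _;
  rewrite scaler_sumr -big_split; apply: eq_bigr => j _ /=;
  rewrite !mxE scalerA -scalerDl; congr (_ *: _).
  by rewrite mulrDl mulrA.
by rewrite mulrDr mulrCA.
Qed.

Lemma table_brk_delta T i j :
  table_brk T (delta_mx 0 i) (delta_mx 0 j) = T i j.
Proof.
rewrite /table_brk (bigD1 i)//= [X in _ + X]big1 ?addr0 => [|k /negPf ki].
  rewrite (bigD1 j)//= [X in _ + X]big1 ?addr0 => [|k /negPf kj].
    by rewrite !mxE !eqxx mulr1 scale1r.
  by rewrite !mxE kj !andbF mulr0 scale0r.
by rewrite big1// => l _; rewrite !mxE ki andbF mul0r scale0r.
Qed.

End Table.

Section A8A9.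
Variable K : fieldType.

Let x3 : 'rV[K]_4 := delta_mx 0 2.
Let x4 : 'rV[K]_4 := delta_mx 0 3.

(* Indices are shifted by one: x_(i+1) is the i-th standard basis vector. *)
Definition table8 (i j : 'I_4) : 'rV[K]_4 :=
  match nat_of_ord i, nat_of_ord j with
  | 0%N, 0%N => x4
  | 0%N, 1%N => x3
  | 1%N, 0%N => - x3
  | _, _ => 0
  end.

Definition table9 (i j : 'I_4) : 'rV[K]_4 :=
  match nat_of_ord i, nat_of_ord j with
  | 0%N, 0%N => x4
  | 0%N, 1%N => x3
  | 1%N, 0%N => - x3
  | 1%N, 1%N => x4
  | _, _ => 0
  end.

Let two_step (T : 'I_4 -> 'I_4 -> 'rV[K]_4) :=
  (forall i j (k : 'I_4), (k < 2)%N -> T i j 0 k = 0) /\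
  (forall i j : 'I_4, ((2 <= i) || (2 <= j))%N -> T i j = 0).

Let two_step_leibniz T : two_step T -> forall a b c,
  table_brk T a (table_brk T b c) =
  table_brk T (table_brk T a b) c + table_brk T b (table_brk T a c).
Proof.
case=> T01 T23.
have low u v (k : 'I_4) : (k < 2)%N -> table_brk T u v 0 k = 0.
  move=> k2; rewrite /table_brk summxE big1// => i _.
  by rewrite summxE big1// => j _; rewrite mxE T01// mulr0.
have nilr w u v : table_brk T w (table_brk T u v) = 0.
  rewrite {1}/table_brk big1// => i _; rewrite big1// => j _.
  have [j2|j2] := ltnP j 2; first by rewrite low// mulr0 scale0r.
  by rewrite T23 ?j2 ?orbT// scaler0.
have nill w u v : table_brk T (table_brk T u v) w = 0.
  rewrite {1}/table_brk big1// => i _; rewrite big1// => j _.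
  have [j2|j2] := ltnP i 2; first by rewrite low// mul0r scale0r.
  by rewrite T23 ?j2// scaler0.
by move=> a b c; rewrite !nilr nill addr0.
Qed.

Let table8_two_step : two_step table8.
Proof.
split=> [[[|[|i]] ?] [[|[|j]] ?] [[|[|k]] ?]|[[|[|i]] ?] [[|[|j]] ?]] //= _;
  by rewrite /table8 /= !mxE ?oppr0.
Qed.

Let table9_two_step : two_step table9.
Proof.
split=> [[[|[|i]] ?] [[|[|j]] ?] [[|[|k]] ?]|[[|[|i]] ?] [[|[|j]] ?]] //= _;
  by rewrite /table9 /= !mxE ?oppr0.
Qed.

Definition A8 : Type := 'rV[K]_4.
HB.instance Definition _ := Vector.on A8.
HB.instance Definition _ := hasLeibnizBracket.Build K A8
  (@table_brk_bilinear K 4 table8) (two_step_leibniz table8_two_step).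

Definition A9 : Type := 'rV[K]_4.
HB.instance Definition _ := Vector.on A9.
HB.instance Definition _ := hasLeibnizBracket.Build K A9
  (@table_brk_bilinear K 4 table9) (two_step_leibniz table9_two_step).

End A8A9.

(* Main.v *)
Require Import Defs.
From HB Require Import structures.
From mathcomp Require Import all_boot all_order all_algebra.
From mathcomp Require Import all_classical all_reals.
From mathcomp Require Import complex.
Import GRing.Theory.
Local Open Scope ring_scope.
Local Open Scope complex_scope.

(** Since [A^3 = 0], the product factors through the plane [A / A^2] and takes
values in [A^2], which also has dimension 2.  Split it into its symmetric and
antisymmetric parts.  By polarization the symmetric part takes values in the
line [Leib A], so after choosing a generator of this line it is a nonzero
symmetric bilinear form on the plane; the antisymmetric part is determined by
its value on one pair of generators.  A nonzero symmetric form on a plane, over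
a field of characteristic not 2 with all square roots, is equivalent to [x^2]
or to [x^2 + y^2].  In generators [u], [v] that put the form in this shape
([normalized_generators]), the product is given by [[u,u]], [[u,v]] = - [[v,u]]
and [[v,v]], the last being 0 or [[u,u]].

The two products [[u,u]] and [[u,v]] then span [A^2], hence by dimension [u],
[v], [[u,v]], [[u,u]] form a basis of [A] ([two_generator_basis]).  Its
structure constants are those of A8 if [[v,v] = 0] and of A9 if
[[v,v] = [u,u]], and taking coordinates is the isomorphism
([coord_row_brk]). *)

Lemma brk_lcs2 {K : fieldType} {A : leibnizAlgType K} (a b : A) :
  brk a b \in lcs A 2.
Proof.
by have /vspanP := subvv (lcs A 2); apply; exists a => //; exists b;
   rewrite //= memvf.
Qed.

Lemma lcs2_sub {K : fieldType} {A : leibnizAlgType K} (U : {vspace A}) :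
  (forall a b, brk a b \in U) -> (lcs A 2 <= U)%VS.
Proof. by move=> brkU; apply/vspanP => _ [a _ [b _ <-]]. Qed.

Lemma brk_lcs2r {K : fieldType} {A : leibnizAlgType K} :
  lcs A 3 = 0%VS -> forall a c : A, c \in lcs A 2 -> brk a c = 0.
Proof.
move=> A3 a c cA2; apply/eqP; rewrite -memv0 -A3.
by have /vspanP := subvv (lcs A 3); apply; exists a => //; exists c.
Qed.

(** [A^2] is also annihilated from the left: by the Leibniz identity
[[[x,y],a]] is a difference of two elements of [A^3], and [A^2] is spanned by
the products [[x,y]]. *)
Lemma brk_lcs2l {K : fieldType} {A : leibnizAlgType K} :
  lcs A 3 = 0%VS -> forall a c : A, c \in lcs A 2 -> brk c a = 0.
Proof.
move=> A3 a c cA2; apply/eqP; rewrite -memv0; move: c cA2.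
have brkl0 x y : brk (brk x y) a = 0.
  have := brk_leibniz x y a.
  rewrite (brk_lcs2r A3 x _ (brk_lcs2 y a)) (brk_lcs2r A3 y _ (brk_lcs2 x a)).
  by rewrite addr0.
move=> c /mem_vspan[s sP]; rewrite memv0 => cs.
rewrite (coord_span (X := in_tuple s) cs) linear_sumlz big1// => i _ /=.
rewrite linearZl_LR /=.
have [x _ [y _ <-]] := sP _ (mem_nth 0 (ltn_ord i)).
by rewrite brkl0 scaler0.
Qed.

Lemma brk_square_Leib {K : fieldType} {A : leibnizAlgType K} (a : A) :
  brk a a \in Leib A.
Proof. by have /vspanP := subvv (Leib A); apply; exists a. Qed.

(** Polarization of the squares that define [Leib A]. *)
Lemma brk_sym_Leib {K : fieldType} {A : leibnizAlgType K} (a b : A) :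
  brk a b + brk b a \in Leib A.
Proof.
have -> : brk a b + brk b a = brk (a + b) (a + b) - brk a a - brk b b.
  rewrite linearDl /= !linearDr /= -[X in X - _ - _]addrA [brk a a + _]addrC.
  by rewrite addrK addrA addrK.
by rewrite !memvB ?brk_square_Leib.
Qed.

Lemma square_neq0 {K : fieldType} {A : leibnizAlgType K} :
  Leib A != 0%VS -> exists u : A, brk u u != 0.
Proof.
move=> Leib0; apply: contrapT => /forallNP sq0; case/negP: Leib0.
rewrite -subv0; apply/vspanP => _ [a _ <-]; rewrite memv0.
by apply/negP => /negP /sq0.
Qed.

Lemma dim_add_line {K : fieldType} {V : vectType K} (U : {vspace V}) (v : V) :
  v \notin U -> \dim (U + <[v]>) = (\dim U).+1.
Proof.
move=> vU; have v0 : v != 0 by apply: contraNneq vU => ->; rewrite mem0v.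
rewrite dimv_disjoint_sum ?dim_vline ?v0 ?addn1//.
apply/eqP; rewrite -subv0; apply/subvP => x /memv_capP[xU /vlineP[c xE]].
rewrite memv0 xE; have [->|c0] := eqVneq c 0; first by rewrite scale0r.
by case/negP: vU; rewrite -(scalerK c0 v) -xE memvZ.
Qed.

(** Diagonalization of the form [q] defined by
[[a,b] + [b,a] = 2 q(a,b) [u,u]], where [u] is any element of nonzero square:
Gram-Schmidt makes the second vector orthogonal to [u], and a square root
rescales its value under [q] to 1 unless that value is 0. *)
Lemma normalized_generators {K : fieldType} {A : leibnizAlgType K} :
  (2 : K) != 0 -> (forall c : K, exists s, s ^+ 2 = c) ->
  \dim {:A} = 4 -> \dim (lcs A 2) = 2 -> \dim (Leib A) = 1 ->
  lcs A 3 = 0%VS ->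
  exists u v : A,
  [/\ u \notin lcs A 2, v \notin (lcs A 2 + <[u]>)%VS,
      brk v u = - brk u v & brk v v = 0 \/ brk v v = brk u u].
Proof.
move=> two0 sqrtK dimA dimA2 dimL A3.
have [u uu0] : exists u : A, brk u u != 0.
  by apply: square_neq0; apply: contra_eqN dimL => /eqP ->; rewrite dimv0.
have LeibE x : x \in Leib A -> exists c, x = c *: brk u u.
  have /eqP <- : (<[brk u u]> == Leib A)%VS.
    by rewrite eqEdim dimL dim_vline uu0 -memvE brk_square_Leib.
  by move/vlineP.
have uA2 : u \notin lcs A 2.
  by apply: contra uu0 => /(brk_lcs2r A3 u) ->.
have [w wU] : exists w, w \notin (lcs A 2 + <[u]>)%VS.
  apply: contrapT => /forallNP wU.
  have : (fullv <= lcs A 2 + <[u]>)%VS.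
    by apply/subvP => x _; apply/negPn/negP/wU.
  by move/dimvS; rewrite dim_add_line// dimA dimA2.
have [c cE] := LeibE _ (brk_sym_Leib u w).
(* As [[u,w] + [w,u] = c [u,u]], this is the projection of [w] orthogonal to
   [u] for the symmetric part of the product. *)
pose w' := w - (c / 2) *: u.
have w'U : w' \notin (lcs A 2 + <[u]>)%VS.
  by rewrite /w' rpredBr// memvZ// (subvP (addvSr _ _)) ?memv_line.
have w'u : brk w' u = - brk u w'.
  apply/eqP; rewrite -addr_eq0 addrC /w' linearBl linearBr /=.
  rewrite linearZl_LR linearZr_LR /=.
  have half2 : c / 2 + c / 2 = c by rewrite -mulr2n -[LHS]mulr_natr divfK.
  by rewrite addrACA -opprD cE -scalerDl half2 subrr.
have [d dE] := LeibE _ (brk_square_Leib w').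
have [d0|d0] := eqVneq d 0.
  by exists u, w'; split=> //; left; rewrite dE d0 scale0r.
have [s sd] := sqrtK d.
have s0 : s != 0 by apply: contraNneq d0 => s0; rewrite -sd s0 expr0n.
exists u, (s^-1 *: w'); split=> //.
- by apply: contra w'U => sw; rewrite -(scalerKV s0 w') memvZ.
- by rewrite linearZl_LR linearZr_LR /= w'u scalerN.
right; rewrite linearZl_LR linearZr_LR /= dE !scalerA -sd.
by rewrite expr2 mulrACA mulVf// mulr1 scale1r.
Qed.

(** It is enough that these four vectors span [A].  With [A^2] central, every
product is a combination of [[u,u]], [[u,v]], [[v,u]] and [[v,v]], and the last
two are multiples of the first two; so [[u,v]] and [[u,u]] span [A^2], while
[u] and [v] span [A] modulo [A^2] because the dimensions add up to 4. *)
Lemma two_generator_basis {K : fieldType} {A : leibnizAlgType K} (u v : A) :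
  \dim {:A} = 4 -> \dim (lcs A 2) = 2 -> lcs A 3 = 0%VS ->
  u \notin lcs A 2 -> v \notin (lcs A 2 + <[u]>)%VS ->
  brk v u = - brk u v -> brk v v = 0 \/ brk v v = brk u u ->
  basis_of fullv [:: u; v; brk u v; brk u u].
Proof.
move=> dimA dimA2 A3 uA2 vU vu vv.
have A_gen : fullv = (lcs A 2 + <[u]> + <[v]>)%VS.
  by apply/esym/eqP; rewrite eqEdim subvf dimA !dim_add_line// dimA2.
have vvW : brk v v \in <<[:: brk u v; brk u u]>>%VS.
  by case: vv => ->; rewrite ?mem0v// memv_span// !inE eqxx orbT.
have A2W : (lcs A 2 <= <<[:: brk u v; brk u u]>>)%VS.
  apply: lcs2_sub => a b.
  have gen x : exists c, exists k l, c \in lcs A 2 /\ x = c + k *: u + l *: v.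
    have : x \in fullv by rewrite memvf.
    rewrite A_gen => /memv_addP[_ /memv_addP[c cA2 [_ /vlineP[k ->] ->]]].
    by move=> [_ /vlineP[l ->] ->]; exists c, k, l.
  have [c [k [l [cA2 ->]]]] := gen a; have [d [m [n [dA2 ->]]]] := gen b.
  rewrite !(linearDl, linearDr, linearZl_LR, linearZr_LR) /=.
  rewrite !(brk_lcs2l A3 _ c cA2) !(brk_lcs2r A3 _ d dA2) vu.
  have uvW : brk u v \in <<[:: brk u v; brk u u]>>%VS.
    by rewrite memv_span// mem_head.
  have uuW : brk u u \in <<[:: brk u v; brk u u]>>%VS.
    by rewrite memv_span// !inE eqxx orbT.
  by rewrite !(rpredD, rpredZ, rpredN, rpred0).
rewrite basisEdim dimA leqnn andbT A_gen !subv_add -!memvE.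
rewrite !memv_span ?inE ?eqxx ?orbT// !andbT (subv_trans A2W)//.
by apply/sub_span => x; rewrite !inE => /orP[] /eqP ->; rewrite eqxx !orbT.
Qed.

Definition coord_row {K : fieldType} {V : vectType K} {n : nat}
  (X : n.-tuple V) (v : V) : 'rV[K]_n := \row_i coord X i v.

Lemma coord_row_is_linear {K : fieldType} {V : vectType K} {n : nat}
  (X : n.-tuple V) : linear (coord_row X).
Proof. by move=> k u v; apply/rowP => i; rewrite !mxE linearP. Qed.

HB.instance Definition _ (K : fieldType) (V : vectType K) (n : nat)
    (X : n.-tuple V) :=
  GRing.isLinear.Build K V 'rV[K]_n *:%R (coord_row X) (coord_row_is_linear X).

Lemma coord_row_bij {K : fieldType} {V : vectType K} {n : nat}
  (X : n.-tuple V) : basis_of fullv X -> bijective (coord_row X).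
Proof.
move=> bX; exists (fun r : 'rV[K]_n => \sum_i r 0 i *: X`_i) => [v|r].
  rewrite [RHS](coord_basis bX (memvf v)).
  by apply: eq_bigr => i _; rewrite mxE.
by apply/rowP => i; rewrite mxE coord_sum_free// (basis_free bX).
Qed.

(** Both sides are bilinear, so comparing them on the basis suffices: the rows
of [T] are the coordinates of the products of basis vectors. *)
Lemma coord_row_brk {K : fieldType} {A : leibnizAlgType K} {n : nat}
    (X : n.-tuple A) (T : 'I_n -> 'I_n -> 'rV[K]_n) :
  basis_of fullv X ->
  (forall i j : 'I_n, brk X`_i X`_j = \sum_k T i j 0 k *: X`_k) ->
  {morph coord_row X : a b / brk a b >-> table_brk T a b}.
Proof.
move=> bX XT a b.
rewrite {1}(coord_basis bX (memvf a)) {1}(coord_basis bX (memvf b)).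
rewrite linear_sumlz linear_sum; apply: eq_bigr => i _ /=.
rewrite linear_sumr linear_sum; apply: eq_bigr => j _ /=.
rewrite linearZl_LR linearZr_LR /= scalerA linearZ /= !mxE XT; congr (_ *: _).
by apply/rowP => k; rewrite mxE coord_sum_free// (basis_free bX).
Qed.

(** The complex numbers enter only through square roots and the invertibility
of 2. *)
Lemma quadratically_closed_A8_A9 {K : fieldType} {A : leibnizAlgType K} :
  (2 : K) != 0 -> (forall c : K, exists s, s ^+ 2 = c) ->
  \dim {:A} = 4 -> \dim (lcs A 2) = 2 -> \dim (Leib A) = 1 ->
  lcs A 3 = 0%VS ->
  leibniz_isomorphic A (A8 K) \/ leibniz_isomorphic A (A9 K).
Proof.
move=> two0 sqrtK dimA dimA2 dimL A3.
have [u [v [uA2 vU vu vv]]] :=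
  normalized_generators two0 sqrtK dimA dimA2 dimL A3.
have bX := two_generator_basis u v dimA dimA2 A3 uA2 vU vu vv.
pose X := [tuple u; v; brk u v; brk u u].
have nl x y a : brk (brk x y) a = 0 := brk_lcs2l A3 a _ (brk_lcs2 x y).
have nr x y a : brk a (brk x y) = 0 := brk_lcs2r A3 a _ (brk_lcs2 x y).
have iso_table (T : 'I_4 -> 'I_4 -> 'rV[K]_4) :
  (forall i j : 'I_4, brk X`_i X`_j = \sum_k T i j 0 k *: X`_k) ->
  exists2 f : {linear A -> 'rV[K]_4}, bijective f &
    {morph f : a b / brk a b >-> table_brk T a b}.
  by move=> XT; exists (coord_row X); [exact: coord_row_bij|exact: coord_row_brk].
case: vv => vv; [left|right].
  refine (iso_table (table8 K) _).
  move=> [[|[|[|[|//]]]] ?] [[|[|[|[|//]]]] ?]; rewrite !big_ord_recl big_ord0 /=.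
  all: rewrite /table8 /= ?mxE /= ?nl ?nr ?vu ?vv.
  all: rewrite ?oppr0 ?scaleN1r ?scale1r ?scale0r ?add0r ?addr0 //.
refine (iso_table (table9 K) _).
move=> [[|[|[|[|//]]]] ?] [[|[|[|[|//]]]] ?]; rewrite !big_ord_recl big_ord0 /=.
all: rewrite /table9 /= ?mxE /= ?nl ?nr ?vu ?vv.
all: rewrite ?oppr0 ?scaleN1r ?scale1r ?scale0r ?add0r ?addr0 //.
Qed.

Theorem theorem2p3 (R : realType) (A : leibnizAlgType R[i])
  (dimA : \dim {:A} = 4%N)
  (nonsplitA : ~ split_leibniz A)
  (nonLieA : Leib A <> 0%VS)
  (nilpA : nilpotent_leibniz A)
  (dimA2 : \dim (lcs A 2) = 2%N)
  (dimA3 : \dim (lcs A 3) = 0%N)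
  (dimLeib : \dim (Leib A) = 1%N) :
  leibniz_isomorphic A (A8 R[i]) \/ leibniz_isomorphic A (A9 R[i]).
Proof.
apply: quadratically_closed_A8_A9 => //.
- by rewrite Num.Theory.pnatr_eq0.
- by move=> c; exists (sqrtc c); rewrite sqr_sqrtc.
- by apply/eqP; rewrite -dimv_eq0 dimA3.
Qed.
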